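(* Let $s>2$ and $r>\frac{s}{s-2}$ be real numbers. Then there exist positive definite matrices $A_\varepsilon,B_\varepsilon\in M_3(\mathbb C)$ (indexed by small $\varepsilon>0$) such that \[ \Phi_{r,s}(A_\varepsilon,B_\varepsilon)<0 \] for all sufficiently small $\varepsilon>0$. In fact, \[ \Phi_{r,s}(A_\varepsilon,B_\varepsilon)\to-\infty\qquad(\varepsilon\downarrow0). \]
   Context: For $r,s\geq0$ and positive semidefinite matrices $A,B$ of the same size, \[ \Phi_{r,s}(A,B):=\operatorname{Tr}A^{r+s}B^s-\operatorname{Tr}A^r(A^{1/2}BA^{1/2})^s , \] with powers taken by the functional calculus. *)

(* Defs.v *)
From mathcomp Require Import all_boot all_order all_algebra.
From mathcomp Require Import complex sesquilinear spectral.
From mathcomp Require Import all_classical all_reals all_analysis.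

Set Implicit Arguments.
Unset Strict Implicit.
Unset Printing Implicit Defensive.

Import Order.TTheory GRing.Theory Num.Theory.
Local Open Scope ring_scope.
Local Open Scope complex_scope.
Local Open Scope sesquilinear_scope.

(* The strict order of R[i] is partial: 0 < z says that z is real and
   positive. *)
Definition posdefmx (R : realType) (n : nat) (A : 'M[R[i]]_n) : Prop :=
  A \is hermsymmx /\
  forall v : 'cV[R[i]]_n, v != 0 -> 0 < (v ^t* *m A *m v) 0 0.

(* Continuous functional calculus: if A = P^-1 diag(d) P with P unitary and d
   real, then f(A) = P^-1 diag(f(d)) P.  It is meaningful for hermitian A, for
   which A = P^-1 diag(d) P does hold with d real; the value is a junk value
   otherwise. *)
Definition mxfun (R : realType) (n : nat) (f : R -> R) (A : 'M[R[i]]_n) :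
    'M[R[i]]_n :=
  invmx (spectralmx A)
  *m diag_mx (map_mx (fun z : R[i] => (f (complex.Re z))%:C) (spectral_diag A))
  *m spectralmx A.

(* A^t for positive semidefinite A.  Since 0 `^ t = (t == 0)%:R, this has
   A^0 = 1. *)
Definition powmx (R : realType) (n : nat) (A : 'M[R[i]]_n) (t : R) :
    'M[R[i]]_n :=
  mxfun (fun x : R => x `^ t) A.

(* Valued in R[i], since a trace of complex matrices is; it is real for positive
   semidefinite A and B. *)
Definition Phi (R : realType) (n : nat) (r s : R) (A B : 'M[R[i]]_n) : R[i] :=
  \tr (powmx A (r + s) *m powmx B s)
  - \tr (powmx A r
         *m powmx (powmx A (2^-1) *m B *m powmx A (2^-1)) s).

(* Main.v *)
(* Phi is homogeneous of degree s in B, so one pair (A, B) with Phi < 0 suffices: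
   keep A and replace B by B / e.

   For such a pair, let A = diag(1, 4a, a) and
   B = u u^T + 4d w w^T + d z z^T with u = (0,1,1), w = (1,1,-1), z = (2,-1,1)
   orthogonal, so that B has eigenvalues 2, 12d, 6d.  Since u has no first
   component, Tr A^(r+s) B^s is at most (12d)^s + 2 2^s (4a)^(r+s).  On the other
   hand C = A^(1/2) B A^(1/2) couples the first basis vector to an eigenvalue of
   order a, because A^(1/2) destroys the orthogonality of u with w and z; this
   gives Tr A^r C^s >= (C^s)_00 >= a^(s-1) d^2.  With d = a^x the second quantity
   wins as a -> 0 as soon as (s-1)/(s-2) < x < (r+1)/2, and such an x exists
   exactly when r > s/(s-2). *)
Require Import Defs.
From mathcomp Require Import all_boot all_order all_algebra.
From mathcomp Require Import complex sesquilinear spectral.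
From mathcomp Require Import all_classical all_reals all_analysis.
From mathcomp Require Import ring lra.
Set Implicit Arguments.
Unset Strict Implicit.
Unset Printing Implicit Defensive.
Import Order.TTheory GRing.Theory Num.Theory.
Import numFieldNormedType.Exports.
Local Open Scope classical_set_scope.
Local Open Scope ring_scope.
Local Open Scope complex_scope.
Local Open Scope sesquilinear_scope.

Local Notation cmx := (map_mx (real_complex _)).

(** * Choice of the parameters [a] and [d] *)

(** With d = a^x, both terms on the left are powers of [a], up to constants, whose exponents exceed
    the exponent s - 1 + 2x of the right-hand side, so a small [a] absorbs the constants. *)
Lemma powR_params (R : realType) (r s : R) (hs : 2 < s) (hr : s / (s - 2) < r) :
  exists a d : R, [/\ 0 < a <= 1, 0 < d <= a / 8 &
    (12 * d) `^ s + 2 * 2 `^ s * (4 * a) `^ (r + s) < a `^ (s - 1) * d ^+ 2].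
Proof.
have s2 : 0 < s - 2 by lra.
(* The midpoint of the admissible interval: with t = 1/(s-2) its ends are 1 + t and (r+1)/2, and the
   hypothesis on [r] reads r > 1 + 2t. *)
pose x := ((s - 1) / (s - 2) + (r + 1) / 2) / 2.
have E1 : (s - 1) / (s - 2) = 1 + (s - 2)^-1 by field; lra.
have E2 : s / (s - 2) = 1 + 2 * (s - 2)^-1 by field; lra.
have i0 : 0 < (s - 2)^-1 by rewrite invr_gt0.
have xl : (s - 1) / (s - 2) < x by rewrite /x E1; rewrite E2 in hr; lra.
have xu : x < (r + 1) / 2 by rewrite /x E1; rewrite E2 in hr; lra.
have x1 : 1 < x by rewrite E1 in xl; lra.
have y1 : 0 < x * s - (s - 1 + 2 * x).
  by move: xl; rewrite ltr_pdivrMr //; nra.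
have y2 : 0 < r + s - (s - 1 + 2 * x) by lra.
(* The margin x - 1 serves [d <= a / 8]; the other two serve the terms (12d)^s and (4a)^(r+s). *)
pose e := Num.min (x - 1) (Num.min (x * s - (s - 1 + 2 * x)) (r + s - (s - 1 + 2 * x))).
have e0 : 0 < e by rewrite !lt_min y1 y2 subr_gt0 x1.
have [e1 e2 e3] : [/\ e <= x - 1, e <= x * s - (s - 1 + 2 * x)
    & e <= r + s - (s - 1 + 2 * x)].
  by split; rewrite /e !ge_min lexx ?orbT.
(* The choice of [a] below makes K a^e = 1/2; the summand 8 then forces a^(x-1) <= a^e <= 1/16. *)
pose K := 12 `^ s + 2 * 2 `^ s * 4 `^ (r + s) + 8 : R.
have p1 : 0 <= 12 `^ s :> R by exact: powR_ge0.
have p2 : 0 <= 2 * 2 `^ s * 4 `^ (r + s) :> R by rewrite !mulr_ge0 ?powR_ge0.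
have K8 : 8 <= K by rewrite /K; lra.
pose a := (2 * K)^-1 `^ e^-1.
have k0 : 0 < (2 * K)^-1 by rewrite invr_gt0; lra.
have k1 : (2 * K)^-1 <= 1 by rewrite invf_le1; lra.
have a0 : 0 < a by exact: powR_gt0.
have a1 : a <= 1.
  have one : 1 `^ e^-1 = 1 :> R by rewrite powR1.
  rewrite -[leRHS]one ge0_ler_powR ?nnegrE ?invr_ge0 ?(ltW e0) //; lra.
have Kae : K * a `^ e = 2^-1.
  by rewrite /a -powRrM mulVf ?gt_eqF // powRr1 ?(ltW k0) //; field; lra.
have small y : e <= y -> a `^ y <= a `^ e.
  by move=> ey; rewrite ger_powR // a0 a1.
exists a, (a `^ x); split; first by rewrite a0.
  rewrite powR_gt0 //=.
  rewrite -(@mulr_powRB1 _ a x) ?(ltW a0) ?ler_pM2l //; last lra.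
  by have := small _ e1; nra.
have -> : a `^ (s - 1) * a `^ x ^+ 2 = a `^ (s - 1 + 2 * x).
  by rewrite expr2 -!powRD ?(gt_eqF a0) ?implybT //; congr (_ `^ _); ring.
rewrite !powRM ?powR_ge0 ?(ltW a0) // -powRrM.
have sp y : a `^ (s - 1 + 2 * x) * a `^ (y - (s - 1 + 2 * x)) = a `^ y.
  by rewrite -powRD ?(gt_eqF a0) ?implybT //; congr (_ `^ _); ring.
rewrite -(sp (x * s)) -(sp (r + s)).
have G : 0 < a `^ (s - 1 + 2 * x) by exact: powR_gt0.
have := small _ e2; have := small _ e3.
set u := a `^ (x * s - _); set v := a `^ (r + s - _).
move: p1 p2 Kae; rewrite /K.
clear k1; set k1 := 12 `^ s; set k2 := 2 * 2 `^ s * 4 `^ (r + s).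
move=> k1p k2p Kae vle ule.
have k1u : k1 * u <= k1 * a `^ e by rewrite ler_wpM2l.
have k2v : k2 * v <= k2 * a `^ e by rewrite ler_wpM2l.
have -> : k1 * (a `^ (s - 1 + 2 * x) * u) +
    2 * 2 `^ s * (4 `^ (r + s) * (a `^ (s - 1 + 2 * x) * v)) =
    a `^ (s - 1 + 2 * x) * (k1 * u + k2 * v) by rewrite /k2; ring.
have ae : 0 < a `^ e by exact: powR_gt0.
by rewrite -[ltRHS]mulr1 ltr_pM2l //; lra.
Qed.

(** * Functional calculus and positive definite matrices *)

Lemma conj_real (R : realType) (x : R) : Num.conj x%:C = x%:C.
Proof. by rewrite conj_Creal // complex_real. Qed.

Lemma cmx_trmxC (R : realType) m n (M : 'M[R]_(m, n)) : (cmx M)^t* = cmx M^T.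
Proof. by apply/matrixP => i j; rewrite !mxE conj_real. Qed.

Lemma hermsymmxP (R : realType) n (A : 'M[R[i]]_n) :
  reflect (A^t* = A) (A \is hermsymmx).
Proof.
apply: (iffP idP) => [/is_hermitianmxP|E]; first by rewrite expr0 scale1r => /esym.
by apply/is_hermitianmxP; rewrite expr0 scale1r.
Qed.

(* P need not be unitary: if P^-1 diag(d) P = S^-1 diag(D) S then P S^-1
   intertwines diag(d) and diag(D), hence also diag(f(d)) and diag(f(D)). *)
Lemma mxfun_diag (R : realType) n (f : R -> R) (A P P' : 'M[R[i]]_n)
    (d : 'rV[R]_n) :
  A \is hermsymmx -> P' *m P = 1%:M -> A = P' *m diag_mx (cmx d) *m P ->
  mxfun f A = P' *m diag_mx (cmx (map_mx f d)) *m P.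
Proof.
move=> /hermitian_normalmx /orthomx_spectralP AE P'P AP.
have PP' := mulmx1C P'P.
rewrite /mxfun; move: AE (spectral_unit A).
set S := spectralmx A; set D := spectral_diag A => AE uS.
have H : diag_mx (cmx d) *m (P *m invmx S) = P *m invmx S *m diag_mx D.
  transitivity (P *m A *m invmx S).
    by rewrite AP !mulmxA PP' mul1mx.
  by rewrite {1}AE !mulmxA mulmxK.
have HE : diag_mx (cmx (map_mx f d)) *m (P *m invmx S) = P *m invmx S *m
    diag_mx (map_mx (fun z : R[i] => (f (complex.Re z))%:C) D).
  (* Entrywise, either M_ij = 0 or D_j = d_i; in the second case D_j is real and [f] takes the same
     value at both. *)
  apply/matrixP => i j; move/matrixP/(_ i j): H.
  rewrite !mul_diag_mx !mul_mx_diag; move: (P *m _) => M.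
  rewrite !mxE.
  have [->|M0] := eqVneq (M i j) 0; first by rewrite !(mulr0, mul0r).
  by rewrite mulrC => /(mulfI M0) <-; rewrite mulrC.
have /(congr1 (mulmx P')) := HE.
rewrite !mulmxA P'P mul1mx => <-.
by rewrite mulmxKV.
Qed.

(** For unitary [P] the weights are the spectral measure of the i-th basis vector; through them
    scalar inequalities pass to diagonal entries. *)
Lemma mxE_conj_diag (R : realType) n (P : 'M[R[i]]_n) (d : 'rV[R]_n) i :
  (P^t* *m diag_mx (cmx d) *m P) i i = \sum_k (d 0 k)%:C * `|P k i| ^+ 2.
Proof.
rewrite mxE; apply: eq_bigr => k _.
by rewrite mul_mx_diag !mxE normCK mulrAC mulrC (mulrC (_^*)).
Qed.

Lemma hermsymmx_conj_diag (R : realType) n m (P : 'M[R[i]]_(m, n)) (d : 'rV[R]_m) :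
  P^t* *m diag_mx (cmx d) *m P \is hermsymmx.
Proof.
apply/hermsymmxP; rewrite !trmx_mul !map_mxM /= trmxCK mulmxA.
have dE : map_mx Num.conj (cmx d) = cmx d.
  by apply/matrixP => i j; rewrite !mxE conj_real.
by rewrite tr_diag_mx map_diag_mx dE.
Qed.

(** Invertibility of [P] keeps [P *m v] nonzero. Not asking for a unitary [P] admits the
    unnormalised eigenvectors of B and their products with A^(1/2). *)
Lemma posdefmx_conj_diag (R : realType) n (P : 'M[R[i]]_n) (d : 'rV[R]_n) :
  P \in unitmx -> (forall k, 0 < d 0 k) ->
  posdefmx (P^t* *m diag_mx (cmx d) *m P).
Proof.
move=> uP d0; split; first exact: hermsymmx_conj_diag.
move=> v v0.
have -> : (v^t* *m (P^t* *m diag_mx (cmx d) *m P) *m v) 0 0 =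
    \sum_k (d 0 k)%:C * `|(P *m v) k 0| ^+ 2.
  have -> : v^t* *m (P^t* *m diag_mx (cmx d) *m P) *m v =
      (P *m v)^t* *m diag_mx (cmx d) *m (P *m v).
    by rewrite trmx_mul map_mxM !mulmxA.
  rewrite mxE; apply: eq_bigr => k _.
  by rewrite mul_mx_diag !mxE normCK mulrAC mulrC (mulrC (_^*)).
have Pv0 : P *m v != 0.
  by apply: contraNneq v0 => Pv; rewrite -(mulKmx uP v) Pv mulmx0.
have [k Pvk] : exists k, (P *m v) k 0 != 0.
  apply/existsP; apply: contraNT Pv0 => /existsPn H.
  by apply/eqP/matrixP => i j; rewrite ord1 [RHS]mxE; apply/eqP/negPn/H.
rewrite (bigD1 k) //= ltr_pwDl //.
  by rewrite mulr_gt0 ?ltcR ?d0 // exprn_gt0 // normr_gt0.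
by apply: sumr_ge0 => j _; rewrite mulr_ge0 ?exprn_ge0 // lecR ltW.
Qed.

Lemma posdefmx_spectral (R : realType) n (A : 'M[R[i]]_n) : posdefmx A ->
  exists P (d : 'rV[R]_n), [/\ P \is unitarymx, forall k, 0 < d 0 k &
    A = P^t* *m diag_mx (cmx d) *m P].
Proof.
move=> [Ah Ap]; have /hermitian_normalmx /orthomx_spectralP := Ah.
have uP := spectral_unitarymx A; rewrite (invmx_unitary uP).
move: uP; set P := spectralmx A; set D := spectral_diag A => uP AE.
(* In the order of [R[i]] this also makes the eigenvalues real, which the end of the proof relies
   on. *)
have D0 k : 0 < D 0 k.
  have /unitarymxP PP := uP.
  pose w : 'cV[R[i]]_n := P^t* *m delta_mx k 0.
  have -> : D 0 k = (w^t* *m A *m w) 0 0.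
    rewrite /w trmx_mul map_mxM trmxCK {1}AE !mulmxA.
    rewrite -(mulmxA _ P (P^t*)) PP mulmx1 -(mulmxA _ P (P^t*)) PP mulmx1.
    by rewrite trmx_delta map_delta_mx -rowE -colE !mxE eqxx.
  apply: Ap; apply/eqP => /(congr1 (mulmx P)); rewrite mulmxA PP mul1mx mulmx0.
  by move/matrixP/(_ k 0)/eqP; rewrite !mxE !eqxx oner_eq0.
exists P, (map_mx (@complex.Re R) D); split=> //.
  by move=> k; move: (D0 k); rewrite mxE ltcE => /andP[].
have <- : D = cmx (map_mx (@complex.Re R) D); last exact: AE.
apply/matrixP => i k; rewrite !mxE ord1.
by move: (D0 k); case: (D 0 k) => a b; rewrite ltcE /= => /andP[/eqP ->].
Qed.

Lemma posdefmxZ (R : realType) n (A : 'M[R[i]]_n) (c : R) : 0 < c ->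
  posdefmx A -> posdefmx (c%:C *: A).
Proof.
move=> c0 [/hermsymmxP Ah Ap]; split.
  by apply/hermsymmxP; rewrite linearZ map_mxZ /= Ah conj_real.
by move=> v v0; rewrite -scalemxAr -scalemxAl mxE mulr_gt0 ?ltcR ?Ap.
Qed.

Lemma powmxZ (R : realType) n (A : 'M[R[i]]_n) (c s : R) : posdefmx A -> 0 <= c ->
  powmx (c%:C *: A) s = (c `^ s)%:C *: powmx A s.
Proof.
move=> Ap c0; have [P [d [uP d0 AE]]] := posdefmx_spectral Ap.
have PP : P^t* *m P = 1%:M by apply: mulmx1C; apply/unitarymxP.
have cd : c%:C *: A = P^t* *m diag_mx (cmx (c *: d)) *m P.
  by rewrite {1}AE map_mxZ /= linearZ /= -scalemxAr -scalemxAl.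
rewrite /powmx (mxfun_diag _ _ PP cd); last first.
  by rewrite cd hermsymmx_conj_diag.
rewrite (mxfun_diag _ (proj1 Ap) PP AE).
rewrite scalemxAl scalemxAr -linearZ; congr (_ *m diag_mx _ *m _).
by apply/matrixP => i j; rewrite !mxE powRM ?rmorphM // ord1 ltW.
Qed.

(** * Lower bound for diagonal entries of powers *)

(** A cubic can be evaluated at a matrix by products alone. For x <= c it is nonpositive; for x > c
    it is at most x^2 L, while c^(s-2) <= x^(s-2). *)
Lemma powR_ge_cubic (R : realType) (s mu c L x : R) :
  2 <= s -> 0 <= mu <= c -> 0 <= x <= L ->
  c `^ (s - 2) / L * ((x - mu) ^+ 2 * (x - c)) <= x `^ s.
Proof.
move=> s2 /andP[mu0 muc] /andP[x0 xL].
have c0 := le_trans mu0 muc.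
have L0 := le_trans x0 xL.
have k0 : 0 <= c `^ (s - 2) / L by rewrite divr_ge0 ?powR_ge0.
have [xc|cx] := leP x c.
  apply: le_trans (powR_ge0 _ _); rewrite mulr_ge0_le0 // mulr_ge0_le0 ?sqr_ge0 //.
  by rewrite subr_le0.
have x0' : 0 < x by exact: le_lt_trans c0 cx.
have L0' : 0 < L by exact: lt_le_trans x0' xL.
have -> : x `^ s = x `^ (s - 2) * x ^+ 2.
  by rewrite -(powR_mulrn 2) // -powRD ?(gt_eqF x0') ?implybT //; congr (_ `^ _); ring.
apply: (@le_trans _ _ (c `^ (s - 2) / L * (x ^+ 2 * L))).
  rewrite ler_wpM2l // ler_pM ?sqr_ge0 ?subr_ge0 ?(ltW cx) //; last lra.
  by rewrite lerXn2r ?nnegrE //; lra.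
have -> : c `^ (s - 2) / L * (x ^+ 2 * L) = c `^ (s - 2) * x ^+ 2 by field; lra.
rewrite ler_wpM2r ?sqr_ge0 // ge0_ler_powR ?nnegrE ?subr_ge0 //; exact: ltW.
Qed.

Lemma powmx_diag_ge0 (R : realType) n (C : 'M[R[i]]_n) (s : R) (i : 'I_n) :
  posdefmx C -> 0 <= powmx C s i i.
Proof.
move=> Cp; have [P [d [uP d0 CE]]] := posdefmx_spectral Cp.
have PP : P^t* *m P = 1%:M by apply: mulmx1C; apply/unitarymxP.
rewrite /powmx (mxfun_diag _ (proj1 Cp) PP CE) mxE_conj_diag.
by apply: sumr_ge0 => k _; rewrite mulr_ge0 ?exprn_ge0 // lecR mxE powR_ge0.
Qed.

(* With mu = C i i the (i, i) entry of C - mu%:M vanishes, so that only the coupling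
   of i to the other coordinates enters the bound. *)
Lemma powmx_diag_ge (R : realType) n (C : 'M[R[i]]_n) (s mu c L : R) (i : 'I_n) :
  posdefmx C -> 2 <= s -> 0 <= mu <= c -> \tr C <= L%:C ->
  (c `^ (s - 2) / L)%:C *
    ((C - mu%:C%:M) *m (C - c%:C%:M) *m (C - mu%:C%:M)) i i <= powmx C s i i.
Proof.
move=> Cp s2 muc CL; have [P [d [uP d0 CE]]] := posdefmx_spectral Cp.
have PP' : P *m P^t* = 1%:M by apply/unitarymxP.
have PP : P^t* *m P = 1%:M by apply: mulmx1C.
(* The eigenvalues are positive and sum to the trace. *)
have dL k : 0 <= d 0 k <= L.
  rewrite (ltW (d0 k)) /= -lecR; apply: le_trans CL.
  rewrite CE mxtrace_mulC mulmxA PP' mul1mx mxtrace_diag (bigD1 k) //= mxE lerDl.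
  by apply: sumr_ge0 => j _; rewrite mxE lecR ltW.
have shift z : C - z%:C%:M = P^t* *m diag_mx (cmx (d - const_mx z)) *m P.
  rewrite map_mxB map_const_mx linearB /= diag_const_mx mulmxBr mulmxBl -CE.
  by rewrite mul_mx_scalar -scalemxAl PP scalemx1.
have mul e f : (P^t* *m diag_mx (cmx e) *m P) *m (P^t* *m diag_mx (cmx f) *m P)
    = P^t* *m diag_mx (cmx (\row_k (e 0 k * f 0 k))) *m P.
  rewrite !mulmxA -(mulmxA _ P (P^t*)) PP' mulmx1 -(mulmxA _ (diag_mx _) (diag_mx _)).
  rewrite mulmx_diag; congr (_ *m diag_mx _ *m _).
  by apply/matrixP => a b; rewrite !mxE rmorphM.
rewrite !shift !mul /powmx (mxfun_diag _ (proj1 Cp) PP CE).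
rewrite [leRHS]mxE_conj_diag [X in _ * X <= _]mxE_conj_diag.
rewrite mulr_sumr; apply: ler_sum => k _.
rewrite mulrA ler_wpM2r ?exprn_ge0 // -rmorphM lecR !mxE.
rewrite [X in _ * X <= _](_ : _ = (d 0 k - mu) ^+ 2 * (d 0 k - c)); last by ring.
exact: powR_ge_cubic.
Qed.

(** * The explicit pair of matrices of size 3 *)

Definition diag3 (R : realType) (a b c : R) : 'rV[R]_3 := \row_j [:: a; b; c]`_j.

(* The rows are u, w and z. *)
Definition eigvecs (R : realType) : 'M[R]_3 := \matrix_(i, j)
  (nth [::] [:: [:: 0; 1; 1]; [:: 1; 1; -1]; [:: 2; -1; 1]] i)`_j.

(* Here a = h^2, so that A^(1/2) has entries linear in h. *)
Definition Amx (R : realType) (h : R) : 'M[R]_3 :=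
  diag_mx (diag3 1 (4 * h ^+ 2) (h ^+ 2)).

Definition Bmx (R : realType) (d : R) : 'M[R]_3 :=
  (eigvecs R)^T *m diag_mx (diag3 1 (4 * d) d) *m eigvecs R.

(** The rows are orthogonal with squared norms 2, 3 and 6. This gives the inverse that [mxfun_diag]
    takes as [P'], and no square roots appear. *)
Lemma eigvecsK (R : realType) :
  ((eigvecs R)^T *m diag_mx (diag3 2^-1 3^-1 6^-1)) *m eigvecs R = 1%:M.
Proof.
apply/matrixP => i j; rewrite !mxE !big_ord_recl big_ord0 !mul_mx_diag !mxE /=.
case: i => [[|[|[|//]]] ?]; case: j => [[|[|[|//]]] ?] /=; by field.
Qed.

Lemma map_diag3 (R : realType) (f : R -> R) (a b c : R) :
  map_mx f (diag3 a b c) = diag3 (f a) (f b) (f c).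
Proof. by apply/rowP => -[[|[|[|//]]] ?]; rewrite !mxE. Qed.

Lemma posdefmx_cmx_diag3 (R : realType) (P : 'M[R]_3) (a b c : R) :
  P \in unitmx -> 0 < a -> 0 < b -> 0 < c ->
  posdefmx (cmx (P^T *m diag_mx (diag3 a b c) *m P)).
Proof.
move=> uP a0 b0 c0; rewrite !map_mxM /= -cmx_trmxC map_diag_mx.
apply: posdefmx_conj_diag; first by rewrite map_unitmx.
by case=> [[|[|[|//]]] ?]; rewrite mxE.
Qed.

Lemma Amx_posdef (R : realType) (h : R) : 0 < h -> posdefmx (cmx (Amx h)).
Proof.
move=> h0; rewrite -[Amx h]mulmx1 -[Amx h]mul1mx -{1}trmx1.
by apply: posdefmx_cmx_diag3; rewrite ?unitmx1 ?mulr_gt0 ?exprn_gt0.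
Qed.

Lemma eigvecs_unit (R : realType) : eigvecs R \in unitmx.
Proof. by have [] := mulmx1_unit (eigvecsK R). Qed.

Lemma Bmx_posdef (R : realType) (d : R) : 0 < d -> posdefmx (cmx (Bmx d)).
Proof. by move=> d0; apply: posdefmx_cmx_diag3; rewrite ?eigvecs_unit ?mulr_gt0. Qed.

Lemma powmx_Amx (R : realType) (h t : R) : 0 < h ->
  powmx (cmx (Amx h)) t =
  cmx (diag_mx (diag3 1 ((4 * h ^+ 2) `^ t) ((h ^+ 2) `^ t))).
Proof.
move=> h0; have [Ah _] := Amx_posdef h0.
rewrite /powmx (@mxfun_diag _ _ _ _ 1%:M 1%:M (diag3 1 (4 * h ^+ 2) (h ^+ 2)) Ah).
- by rewrite mulmx1 mul1mx map_diag3 powR1 map_diag_mx.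
- by rewrite mulmx1.
- by rewrite mulmx1 mul1mx map_diag_mx.
Qed.

Lemma powmx_Bmx (R : realType) (d t : R) : 0 < d ->
  powmx (cmx (Bmx d)) t =
  cmx ((eigvecs R)^T *m diag_mx (diag3 (2 `^ t / 2) ((12 * d) `^ t / 3)
    ((6 * d) `^ t / 6)) *m eigvecs R).
Proof.
move=> d0; have [Bh _] := Bmx_posdef d0.
have split x y z : (eigvecs R)^T *m diag_mx (diag3 2^-1 3^-1 6^-1)
    *m diag_mx (diag3 x y z) *m eigvecs R =
    (eigvecs R)^T *m diag_mx (diag3 (x / 2) (y / 3) (z / 6)) *m eigvecs R.
  rewrite -(mulmxA _ (diag_mx _) (diag_mx _)) mulmx_diag; congr (_ *m diag_mx _ *m _).
  by apply/rowP => -[[|[|[|//]]] ?]; rewrite !mxE mulrC.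
rewrite /powmx (@mxfun_diag _ _ _ _ (cmx (eigvecs R))
  (cmx ((eigvecs R)^T *m diag_mx (diag3 2^-1 3^-1 6^-1)))
  (diag3 2 (12 * d) (6 * d)) Bh).
- by rewrite map_diag3 -map_diag_mx -!map_mxM split.
- by rewrite -map_mxM eigvecsK map_mx1.
- rewrite -map_diag_mx -!map_mxM split; congr (cmx (_ *m diag_mx _ *m _)).
  by apply/rowP => -[[|[|[|//]]] ?]; rewrite !mxE /=; field.
Qed.

(** As u has first component 0, the first diagonal entry of B^s is (12d)^s/3 + 2(6d)^s/3. The other
    two are at most 2^s, because d <= 1/8 gives 12d <= 2. *)
Lemma trace_powmx_le (R : realType) (p s h d : R) :
  0 < h -> 0 <= p -> 0 <= s -> 0 < d <= 8^-1 ->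
  \tr (powmx (cmx (Amx h)) p *m powmx (cmx (Bmx d)) s) <=
    ((12 * d) `^ s + 2 * 2 `^ s * (4 * h ^+ 2) `^ p)%:C.
Proof.
move=> h0 p0 s0 /andP[d0 d8].
rewrite powmx_Amx // powmx_Bmx // -map_mxM trace_map_mx lecR.
have q1 : (6 * d) `^ s <= (12 * d) `^ s.
  by rewrite ge0_ler_powR ?nnegrE //; lra.
have q2 : (12 * d) `^ s <= 2 `^ s.
  by rewrite ge0_ler_powR ?nnegrE //; lra.
have q3 : (h ^+ 2) `^ p <= (4 * h ^+ 2) `^ p.
  by have h2 := sqr_ge0 h; rewrite ge0_ler_powR ?nnegrE //; lra.
rewrite /mxtrace !big_ord_recl big_ord0 !mul_diag_mx !mxE.
rewrite !big_ord_recl !big_ord0.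
rewrite !mul_mx_diag !mxE /=.
have := powR_ge0 (h ^+ 2) p; have := powR_ge0 (6 * d) s.
move: q1 q2 q3; move: (_ `^ s) (_ `^ s) (_ `^ s) (_ `^ p) (_ `^ p).
move=> a b c e f ab bc fe a0 f0; nra.
Qed.

Definition Cmx (R : realType) (h d : R) : 'M[R]_3 :=
  diag_mx (diag3 1 (2 * h) h) *m Bmx d *m diag_mx (diag3 1 (2 * h) h).

Lemma sqrt_Amx_Bmx (R : realType) (h d : R) : 0 < h ->
  powmx (cmx (Amx h)) 2^-1 *m cmx (Bmx d) *m powmx (cmx (Amx h)) 2^-1 =
  cmx (Cmx h d).
Proof.
move=> h0; rewrite powmx_Amx // -!map_mxM /Cmx.
have -> : 4 * h ^+ 2 = (2 * h) ^+ 2 by ring.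
by rewrite !powR12_sqrt ?sqr_ge0 // !sqrtr_sqr !gtr0_norm // mulr_gt0.
Qed.

Lemma Cmx_posdef (R : realType) (h d : R) : 0 < h -> 0 < d -> posdefmx (cmx (Cmx h d)).
Proof.
move=> h0 d0; rewrite /Cmx /Bmx -{1}tr_diag_mx !mulmxA -trmx_mul -mulmxA.
apply: posdefmx_cmx_diag3; rewrite ?mulr_gt0 //.
rewrite unitmx_mul eigvecs_unit unitmxE det_diag unitfE.
by rewrite !big_ord_recl big_ord0 !mxE /= !mulf_neq0 ?gt_eqF.
Qed.

Lemma Cmx_trace (R : realType) (h d : R) :
  \tr (Cmx h d) = 8 * d + 5 * h ^+ 2 * (1 + 5 * d).
Proof.
rewrite /Cmx /Bmx mul_mx_diag mul_diag_mx /mxtrace !big_ord_recl big_ord0 !mxE.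
rewrite !big_ord_recl !big_ord0 !mul_mx_diag !mxE /=; ring.
Qed.

(** Since 8d is the first diagonal entry of C, the first row of [D] is (0, 4hd, -2hd), and only the
    lower 2 by 2 block of C - h^2 contributes. *)
Lemma Cmx_cubic (R : realType) (h d : R) (D := Cmx h d - (8 * d)%:M) :
  (D *m (Cmx h d - (h ^+ 2)%:M) *m D) 0 0 = h ^+ 4 * d ^+ 2 * (16 + 500 * d).
Proof.
rewrite {}/D.
have -> : Cmx h d = \matrix_(i, j) (nth [::] [::
    [:: 8 * d; 4 * h * d; - 2 * h * d];
    [:: 4 * h * d; 4 * h ^+ 2 * (1 + 5 * d); 2 * h ^+ 2 * (1 - 5 * d)];
    [:: - 2 * h * d; 2 * h ^+ 2 * (1 - 5 * d); h ^+ 2 * (1 + 5 * d)]] i)`_j.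
  apply/matrixP => i j; rewrite /Cmx /Bmx mul_mx_diag mul_diag_mx !mxE.
  rewrite !big_ord_recl !big_ord0 !mul_mx_diag !mxE.
  by case: i => [[|[|[|//]]] ?]; case: j => [[|[|[|//]]] ?] /=; ring.
rewrite !mxE !big_ord_recl !big_ord0 !mxE !big_ord_recl !big_ord0 !mxE /=; ring.
Qed.

(** * Negativity, scaling and the limit *)

Lemma Phi_neg (R : realType) (r s h d : R) :
  2 < s -> 0 <= r -> 0 < h <= 1 -> 0 < d <= h ^+ 2 / 8 ->
  (12 * d) `^ s + 2 * 2 `^ s * (4 * h ^+ 2) `^ (r + s) < (h ^+ 2) `^ (s - 1) * d ^+ 2 ->
  Phi r s (cmx (Amx h)) (cmx (Bmx d)) < 0.
Proof.
move=> s2 r0 /andP[h0 h1] /andP[d0 dh] small.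
have hh0 : 0 < h ^+ 2 by exact: exprn_gt0.
have hh1 : h ^+ 2 <= 1 by rewrite expr_le1 // ltW.
have Cp := Cmx_posdef h0 d0.
rewrite /Phi subr_lt0 sqrt_Amx_Bmx //.
apply: le_lt_trans (trace_powmx_le _ _ _ _) _ => //; [lra|lra|lra|].
apply: (@lt_le_trans _ _ ((h ^+ 2) `^ (s - 1) * d ^+ 2)%:C); first by rewrite ltcR.
apply: (@le_trans _ _ (powmx (cmx (Cmx h d)) s 0 0)).
  (* Here mu = 8d, c = h^2 and L = 16 h^2; the 16 in L cancels the leading 16 of [Cmx_cubic]. *)
  have muc : 0 <= 8 * d <= h ^+ 2 by lra.
  have trC : \tr (cmx (Cmx h d)) <= (16 * h ^+ 2)%:C.
    by rewrite trace_map_mx lecR Cmx_trace; nra.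
  have := powmx_diag_ge 0 Cp (ltW s2) muc trC.
  apply: le_trans; rewrite -!map_scalar_mx -!map_mxB -!map_mxM [map_mx _ _ 0 0]mxE Cmx_cubic.
  rewrite -rmorphM lecR.
  have -> : (h ^+ 2) `^ (s - 1) = (h ^+ 2) `^ (s - 2) * h ^+ 2.
    by rewrite -[X in _ * X](powRr1 (ltW hh0)) -powRD ?(gt_eqF hh0) ?implybT //;
       congr (_ `^ _); ring.
  have -> : (h ^+ 2) `^ (s - 2) / (16 * h ^+ 2) * (h ^+ 4 * d ^+ 2 * (16 + 500 * d)) =
      (h ^+ 2) `^ (s - 2) * (h ^+ 2 * d ^+ 2 * (1 + 500 / 16 * d)) by field; lra.
  rewrite -mulrA ler_wpM2l ?powR_ge0 // ler_peMr ?mulr_ge0 ?sqr_ge0 //; lra.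
(* A^r is diagonal with first entry 1, so dropping the other nonnegative terms of the trace leaves
   (C^s)_00. *)
have q i := powmx_diag_ge0 s i Cp.
rewrite powmx_Amx // map_diag_mx /mxtrace !big_ord_recl big_ord0 !mul_diag_mx.
move: (powmx _ s) q => W q.
rewrite !mxE /= mul1r addr0 lerDl addr_ge0 // mulr_ge0 ?q //.
  by rewrite lecR powR_ge0.
by rewrite lecR powR_ge0.
Qed.

Lemma PhiZ (R : realType) n (r s c : R) (A B : 'M[R[i]]_n) :
  posdefmx B -> posdefmx (powmx A 2^-1 *m B *m powmx A 2^-1) -> 0 <= c ->
  Phi r s A (c%:C *: B) = (c `^ s)%:C * Phi r s A B.
Proof.
move=> Bp Cp c0.
have lin (M N K : 'M[R[i]]_n) z : M *m (z *: N) *m K = z *: (M *m N *m K).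
  by rewrite -scalemxAr -scalemxAl.
have tr_lin (M N : 'M[R[i]]_n) z : \tr (M *m (z *: N)) = z * \tr (M *m N).
  by rewrite -scalemxAr mxtraceZ.
have EB := powmxZ s Bp c0.
have EC := powmxZ s Cp c0.
by rewrite /Phi lin EB EC mulrBr; congr (_ - _); exact: tr_lin.
Qed.

Theorem theorem2p6 (R : realType) (r s : R) (hs : 2 < s)
    (hr : s / (s - 2) < r) :
  exists A B : R -> 'M[R[i]]_3,
    [/\ \forall e \near (0 : R)^'+, posdefmx (A e) /\ posdefmx (B e),
        \forall e \near (0 : R)^'+, Phi r s (A e) (B e) < 0
      & complex.Re (Phi r s (A e) (B e)) @[e --> (0 : R)^'+] --> -oo].
Proof.
have [a [d [/andP[a0 a1] d0 small]]] := powR_params hs hr.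
have r0 : 0 <= r by apply: ltW; apply: lt_trans hr; rewrite divr_gt0; lra.
pose h := Num.sqrt a.
have hh : h ^+ 2 = a by rewrite sqr_sqrtr // ltW.
have h0 : 0 < h by rewrite sqrtr_gt0.
have h1 : 0 < h <= 1 by rewrite h0 -sqrtr1 ler_wsqrtr.
have := Phi_neg hs r0 h1; rewrite hh => /(_ d d0 small).
have Bp : posdefmx (cmx (Bmx d)) by apply: Bmx_posdef; case/andP: d0.
have Ap := Amx_posdef h0.
have Cp : posdefmx (cmx (Cmx h d)) by apply: Cmx_posdef; case/andP: d0.
rewrite -(sqrt_Amx_Bmx d h0) in Cp.
have PhiE e : 0 < e -> Phi r s (cmx (Amx h)) (e^-1%:C *: cmx (Bmx d)) =
    (e^-1 `^ s)%:C * Phi r s (cmx (Amx h)) (cmx (Bmx d)).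
  by move=> e0; rewrite PhiZ // invr_ge0 ltW.
set p := Phi r s (cmx (Amx h)) (cmx (Bmx d)) in PhiE * => p0.
exists (fun=> cmx (Amx h)), (fun e => e^-1%:C *: cmx (Bmx d)); split.
- near=> e; split; first exact: Ap.
  apply: posdefmxZ; last exact: Bp.
  by rewrite invr_gt0; near: e; exact: nbhs_right_gt.
- near=> e; have e0 : 0 < e by near: e; exact: nbhs_right_gt.
  by rewrite PhiE // pmulr_rlt0 // ltcR powR_gt0 // invr_gt0.
have p0R : complex.Re p < 0 by move: p0; rewrite ltcE => /andP[].
apply/cvgrNyPle => M; near=> e.
have e0 : 0 < e by near: e; exact: nbhs_right_gt.
have e1 : e <= 1 by near: e; exact: nbhs_right_le.
(* As Re p < 0 and e^-1 <= e^(-s), the value is at most Re p / e <= -(|M| + 1); the added 1 keeps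
   the divisor positive. *)
have eM : e * (`|M| + 1) <= - complex.Re p.
  rewrite -ler_pdivlMr ?ltr_wpDl //.
  by near: e; apply: nbhs_right_le; rewrite divr_gt0 ?oppr_gt0 ?ltr_wpDl.
rewrite PhiE // (_ : complex.Re _ = e^-1 `^ s * complex.Re p); last first.
  by move: (p) => [x y]; rewrite /= mul0r subr0.
have ee : e^-1 <= e^-1 `^ s.
  by rewrite le1r_powR // ?invf_ge1 //; lra.
apply: (@le_trans _ _ (e^-1 * complex.Re p)).
  by rewrite ler_wnM2r // ltW.
rewrite mulrC ler_pdivrMr //.
by have := ler_norm (- M); rewrite normrN; nra.
Unshelve. all: by end_near.
Qed.
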